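(* Let $G$ be a finite solvable group, let $d$ be an HJ-degree of $G$, and let $r\in\mathbb{N}$. Then there exists a positive integer $N$ such that for every $r$-coloring of $G^N$ there exists a uniform $G$-variable word $W$ over $G$ of length $N$ and degree $d$ such that the set $\{W(g):g\in G\}$ is monochromatic.
   Context: $\mathbb{N}$ denotes the positive integers and $[n]=\{1,\dots,n\}$. An $r$-coloring of a set $Y$ is a map $Y\to[r]$; a subset is monochromatic if the coloring is constant on it. Let $G$ be a finite group acting on a finite set $X$ (here $X=G$ with the action given by the group multiplication, $(h,g)\mapsto hg$). Fix distinct variables $\{v_g:g\in G\}$ not belonging to $X$. For a nonempty $H\subseteq G$, an $H$-variable word over $X$ of length $N$ is a sequence $W=(w_i)_{i=1}^N$ with $w_i\in X\cup\{v_h:h\in H\}$ such that each set $F_h=\{i\in[N]:w_i=v_h\}$ ($h\in H$) is nonempty. Its degree is $\sum_{h\in H}|F_h|$. It is uniform if all $|F_h|$, $h\in H$, are equal. For $x\in X$, $W(x)\in X^N$ is obtained by keeping letters $w_i\in X$ and replacing each $v_h$ by $hx$. HJ-degree: if $\{e\}=G_0\trianglelefteq G_1\trianglelefteq\dots\trianglelefteq G_n=G$ is a subnormal series (each $G_{i-1}$ normal in $G_i$) with all factors $G_i/G_{i-1}$ cyclic, and $p_i=|G_i/G_{i-1}|$, then the number $\prod_{i=1}^n p_i^{(p_i-1)\prod_{j>i}p_j}$ is called an HJ-degree of $G$. *)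

(* Defs.v *)
From mathcomp Require Import all_boot all_fingroup all_solvable.

Set Implicit Arguments.
Unset Strict Implicit.
Unset Printing Implicit Defensive.

(* A word of length N over X with variables v_g (g : gT): the letter [inl x] is
   the constant x, and [inr g] is the variable v_g. *)
Definition word (gT : finGroupType) (X : finType) (N : nat) : Type :=
  {ffun 'I_N -> X + gT}.

Definition var_pos (gT : finGroupType) (X : finType) (N : nat)
    (W : word gT X N) (h : gT) : {set 'I_N} :=
  [set i | W i == inr h].

Definition is_variable_word (gT : finGroupType) (X : finType) (N : nat)
    (H : {set gT}) (W : word gT X N) : Prop :=
  [/\ H != set0,
      forall (i : 'I_N) (g : gT), W i = inr g -> g \in H
    & forall h : gT, h \in H -> var_pos W h != set0].

Definition word_degree (gT : finGroupType) (X : finType) (N : nat)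
    (H : {set gT}) (W : word gT X N) : nat :=
  \sum_(h in H) #|var_pos W h|.

Definition uniform_word (gT : finGroupType) (X : finType) (N : nat)
    (H : {set gT}) (W : word gT X N) : Prop :=
  forall h k : gT, h \in H -> k \in H -> #|var_pos W h| = #|var_pos W k|.

Definition word_subst (gT : finGroupType) (X : finType) (act : gT -> X -> X)
    (N : nat) (W : word gT X N) (x : X) : {ffun 'I_N -> X} :=
  [ffun i => match W i with inl a => a | inr h => act h x end].

Definition monochromatic (Y : finType) (r : nat) (c : Y -> 'I_r)
    (A : {set Y}) : Prop :=
  forall x y : Y, x \in A -> y \in A -> c x = c y.

(* Only the values K 0, ..., K n of K matter. *)
Definition cyclic_subnormal_series (gT : finGroupType) (G : {group gT})
    (n : nat) (K : nat -> {group gT}) : Prop :=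
  [/\ K 0 :=: 1%g, K n :=: G
    & forall i, i < n -> (K i <| K i.+1)%g /\ cyclic (K i.+1 / K i)%g].

(* Factors are numbered from 0: [factor_order K i] is the order of
   K_(i+1) / K_i, that is, p_(i+1) in the usual numbering from 1. *)
Definition factor_order (gT : finGroupType) (K : nat -> {group gT})
    (i : nat) : nat :=
  #|(K i.+1 / K i)%g|.

Definition is_HJ_degree (gT : finGroupType) (G : {group gT}) (d : nat) : Prop :=
  exists (n : nat) (K : nat -> {group gT}),
    cyclic_subnormal_series G n K /\
    d = \prod_(0 <= i < n)
          factor_order K i ^ ((factor_order K i - 1)
                              * \prod_(i.+1 <= j < n) factor_order K j).

(* Main.v *)
Require Import Defs.
From mathcomp Require Import all_boot all_fingroup all_solvable.
From mathcomp Require Import zify.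

(** Let [H] be normal in [K] with [K / H] cyclic of order [p], generated by the
    class of [g], and suppose that [H] admits words of degree [d].  Substituting
    [H]-words of degree [d] into one another [p] times, once for each coset
    [H g^j], gives words of degree [d^p] whose value has a colour that depends
    only on the coset of the argument.  The cosets are then merged one after the
    other: once [H, ..., H g^(k-1)] are indistinguishable, Ramsey's theorem for
    (p-k)-subsets of positions yields a word with one occurrence of each
    [v_(g^a)], [a < p], that also merges [H g^k].  Each of these [p - 1] steps
    multiplies the degree by [p], so [K] admits words of degree
    [d^p * p^(p-1)], which is the recursion of the HJ-degrees along a series. *)

Set Implicit Arguments.
Unset Strict Implicit.
Unset Printing Implicit Defensive.

Local Open Scope nat_scope.

(** * Ramsey's theorem for subsequences *)

Lemma seq_pigeonhole (T : eqType) (C : finType) (g : T -> C) (m : nat)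
    (t : seq T) :
  #|C| * m < size t -> exists a, m < count (fun x => g x == a) t.
Proof.
move=> lt_t; have szE : size t = \sum_(a : C) count (fun x => g x == a) t.
  elim: t {lt_t} => [|x t IHt] /=; first by rewrite big1.
  rewrite big_split /= -IHt (bigD1 (g x)) //= eqxx big1 // => a.
  by rewrite eq_sym => /negPf->.
apply/existsP; apply: contraLR lt_t => /existsPn small.
rewrite -leqNgt szE -sum_nat_const; apply: leq_sum => a _.
by rewrite leqNgt.
Qed.

(** Finite Ramsey theorem, with subsequences in the role of subsets. The colour is first made to
    depend on the first element alone; the pigeonhole principle then leaves a single colour. *)
Lemma ramsey_subseq (T : eqType) (q : nat) :
  forall (C : finType) (m : nat), exists n, forall (f : seq T -> C) (s : seq T),
    n <= size s -> exists t a, [/\ subseq t s, size t = m &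
      forall u, subseq u t -> size u = q -> f u = a].
Proof.
elim: q => [|q IHq] C m.
  exists m => f s le_m; exists (take m s), (f [::]).
  by split; [exact: take_subseq | exact: size_takel | move=> [|? ?]].
(* On [t] the colour of a (q+1)-subset depends only on its first element. *)
have first_elt k : exists n, forall (f : seq T -> C) (s : seq T), n <= size s ->
    exists t (g : T -> C), [/\ subseq t s, size t = k &
      forall a u, subseq (a :: u) t -> size u = q -> f (a :: u) = g a].
  elim: k => [|k [n IHk]].
    by exists 0 => f s _; exists [::], (fun a => f [:: a]); rewrite sub0seq.
  (* The head [b] is set aside, and the tail is made homogeneous for the [q]-subsets [u] under the
     colour of [b :: u]; [n] elements survive, enough to continue. *)
  have [n' Hn'] := IHq C n; exists n'.+1 => f [//|b s] /= le_s.
  have [t [col [sub_ts sz_t colP]]] := Hn' (fun u => f (b :: u)) s le_s.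
  have [|t' [g [sub_tt sz_t' gP]]] := IHk f t; first by rewrite sz_t.
  exists (b :: t'), (fun x => if x == b then col else g x).
  split => [||a u /=]; last 1 first.
  - case: eqP => [-> sub_u sz_u|_]; last exact: gP.
    by apply: colP => //; apply: subseq_trans sub_tt.
  - by rewrite /= eqxx (subseq_trans sub_tt).
  - by rewrite /= sz_t'.
have [n Hn] := first_elt (#|C| * m).+1; exists n => f s /Hn - /(_ f).
move=> [t [g [sub_ts sz_t gP]]].
have [|a lt_m] := @seq_pigeonhole _ _ g m t; first by rewrite sz_t.
set F := [seq x <- t | g x == a].
have sub_F : subseq (take m F) F by exact: take_subseq.
exists (take m F), a; split=> [||[//|b u] sub_u [sz_u]].
- by apply: subseq_trans sub_F _; apply: subseq_trans sub_ts; apply: filter_subseq.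
- by rewrite size_takel // size_filter ltnW.
have sub_uF := subseq_trans sub_u sub_F.
rewrite (gP _ _ (subseq_trans sub_uF (filter_subseq _ _)) sz_u).
have: b \in F by rewrite (mem_subseq sub_uF) ?mem_head.
by rewrite mem_filter => /andP[/eqP].
Qed.

(** * Words: evaluation, substitution and products of words *)

Definition eval_letter (gT : finGroupType) (x : gT) (w : gT + gT) : gT :=
  match w with inl a => a | inr h => (h * x)%g end.

Definition eval_word (gT : finGroupType) (W : seq (gT + gT)) (x : gT) : seq gT :=
  map (eval_letter x) W.

(* [m h] prescribes the number of occurrences of the variable [v_h]. *)
Definition partition_word (gT : finGroupType) (m : gT -> nat) (S : rel gT) :=
  forall C : finType, exists N, forall c : seq gT -> C,
  exists W : seq (gT + gT), [/\ size W = N,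
    forall k, count_mem (inr k) W = m k &
    forall x y, S x y -> c (eval_word W x) = c (eval_word W y)].

(** This is the task of the outer word in a composition: the inner words have already made the
    colouring insensitive to [S] in each letter. *)
Definition partition_word_mod (gT : finGroupType) (S : rel gT) (m : gT -> nat)
    (S' : rel gT) :=
  forall C : finType, exists N, forall c : seq gT -> C,
  (forall xs ys, size xs = N -> all2 S xs ys -> c xs = c ys) ->
  exists W : seq (gT + gT), [/\ size W = N,
    forall k, count_mem (inr k) W = m k &
    forall x y, S' x y -> c (eval_word W x) = c (eval_word W y)].

Fixpoint eval_blocks (gT : finGroupType) (Vs : seq (seq (gT + gT)))
    (xs : seq gT) : seq gT :=
  match Vs, xs with
  | V :: Vs', x :: xs' => eval_word V x ++ eval_blocks Vs' xs'
  | _, _ => [::]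
  end.

(** The letter [u] is substituted for the argument of [V]: the variable [v_k] taken at [h * x] is
    [v_(k * h)] taken at [x]. *)
Definition comp_letter (gT : finGroupType) (V : seq (gT + gT)) (u : gT + gT) :
    seq (gT + gT) :=
  match u with
  | inl a => map inl (eval_word V a)
  | inr h => [seq match w with inl a => inl a | inr k => inr (k * h)%g end | w <- V]
  end.

Fixpoint comp_word (gT : finGroupType) (Vs : seq (seq (gT + gT)))
    (U : seq (gT + gT)) : seq (gT + gT) :=
  match Vs, U with
  | V :: Vs', u :: U' => comp_letter V u ++ comp_word Vs' U'
  | _, _ => [::]
  end.

Lemma size_eval_word (gT : finGroupType) (W : seq (gT + gT)) (x : gT) :
  size (eval_word W x) = size W.
Proof. exact: size_map. Qed.

Lemma size_eval_blocks (gT : finGroupType) (Vs : seq (seq (gT + gT)))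
    (xs : seq gT) :
  size xs = size Vs -> size (eval_blocks Vs xs) = size (flatten Vs).
Proof.
elim: Vs xs => [|V Vs IH] [|x xs] //= [/IH sz].
by rewrite !size_cat sz size_eval_word.
Qed.

Lemma eval_comp_letter (gT : finGroupType) (V : seq (gT + gT)) (u : gT + gT)
    (x : gT) :
  eval_word (comp_letter V u) x = eval_word V (eval_letter x u).
Proof.
case: u => [a|h] /=; rewrite /eval_word -map_comp.
  by rewrite map_id_in.
by apply: eq_map => -[b|k] //=; rewrite mulgA.
Qed.

Lemma eval_comp_word (gT : finGroupType) (Vs : seq (seq (gT + gT)))
    (U : seq (gT + gT)) (x : gT) :
  eval_word (comp_word Vs U) x = eval_blocks Vs (eval_word U x).
Proof.
elim: Vs U => [|V Vs IH] [|u U] //=.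
by rewrite {1}/eval_word map_cat -!/(eval_word _ _) eval_comp_letter IH.
Qed.

Lemma count_comp_word (gT : finGroupType) (m : gT -> nat)
    (Vs : seq (seq (gT + gT))) (U : seq (gT + gT)) (k : gT) :
    size U = size Vs ->
    (forall V, V \in Vs -> forall h, count_mem (inr h) V = m h) ->
  count_mem (inr k) (comp_word Vs U) =
    \sum_h count_mem (inr h) U * m (k * h^-1)%g.
Proof.
elim: Vs U => [|V Vs IH] [|u U] //=; first by rewrite big1.
move=> [sz] mV; rewrite count_cat IH //; last first.
  by move=> V' V'in; apply: mV; rewrite inE V'in orbT.
under [RHS]eq_bigr do rewrite mulnDl.
rewrite big_split /=; congr (_ + _).
case: u => [a|h] /=.
  by rewrite big1 // count_map (eq_count (a2 := pred0)) ?count_pred0.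
rewrite (bigD1 h) //= eqxx mul1n big1 => [|h' neq_h]; last first.
  rewrite (_ : (inr h == inr h' :> gT + gT) = false) //.
  by apply: contraNF neq_h => /eqP[->].
rewrite addn0 -(mV V (mem_head _ _)) count_map; apply: eq_count => -[b|b] //=.
apply/eqP/eqP => -[]; first by move <-; rewrite mulgK.
by move->; rewrite mulgKV.
Qed.

(** Product argument. [N1] is fixed first, so that [V] can be chosen for a colouring whose colours
    are functions of the [N1] letters that follow. The other blocks are then chosen for the
    colouring that records the outcome for every argument of [V]. Such colours are why [C] is an
    arbitrary finite type. *)
Lemma partition_blocks (gT : finGroupType) (m : gT -> nat) (S : rel gT) :
    partition_word m S ->
  forall (n : nat) (C : finType), exists N, forall c : seq gT -> C,
  exists Vs : seq (seq (gT + gT)), [/\ size Vs = n, size (flatten Vs) = N,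
    forall V, V \in Vs -> forall h, count_mem (inr h) V = m h &
    forall xs ys, size xs = n -> all2 S xs ys ->
      c (eval_blocks Vs xs) = c (eval_blocks Vs ys)].
Proof.
move=> pS; elim=> [|n IHn] C.
  by exists 0 => c; exists [::]; split=> // -[|? ?] [|? ?].
have [N1 H1] := IHn {ffun gT -> C}.
have [N0 H0] := pS {ffun N1.-tuple gT -> C}.
exists (N0 + N1) => c.
have [V [szV mV cV]] := H0 (fun s => [ffun t : N1.-tuple gT => c (s ++ t)]).
have [Vs [szVs szf mVs cVs]] :=
  H1 (fun t => [ffun x => c (eval_word V x ++ t)]).
exists (V :: Vs); split=> [||V'|].
- by rewrite /= szVs.
- by rewrite /= size_cat szV szf.
- by rewrite inE => /orP[/eqP->|/mVs].
move=> [//|x xs] [//|y ys] /= [sz_xs] /andP[Sxy Ss].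
have sz_t : size (eval_blocks Vs xs) == N1.
  by rewrite size_eval_blocks ?szf // sz_xs szVs.
have /ffunP/(_ (Tuple sz_t)) := cV _ _ Sxy; rewrite !ffunE /= => ->.
by have /ffunP/(_ y) := cVs _ _ sz_xs Ss; rewrite !ffunE.
Qed.

(** The blocks absorb [S], so the colouring they induce on [n] letters is one the outer word can
    handle. Each [v_k] arises from [v_h] in the outer word and [v_(k h^-1)] in a block, whence the
    convolution. *)
Lemma partition_word_comp (gT : finGroupType) (m m' m'' : gT -> nat)
    (S S' : rel gT) :
    partition_word m S -> partition_word_mod S m' S' ->
    (forall k, m'' k = \sum_h m' h * m (k * h^-1)%g) ->
  partition_word m'' S'.
Proof.
move=> pS pS' m''E C; have [n Hn] := pS' C.
have [N HN] := partition_blocks pS n C.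
exists N => c; have [Vs [szVs szf mVs cVs]] := HN c.
have [U [szU mU cU]] := Hn (fun xs => c (eval_blocks Vs xs)) cVs.
exists (comp_word Vs U); split=> [|k|x y Sxy].
- rewrite -(size_eval_word _ 1%g) eval_comp_word size_eval_blocks //.
  by rewrite size_eval_word szU szVs.
- rewrite (count_comp_word _ _ mVs) ?szU ?szVs // m''E.
  by apply: eq_bigr => h _; rewrite mU.
- by rewrite !eval_comp_word; apply: cU.
Qed.

(** * Cosets of [H]: separate homogeneity, then merging *)

Definition below (gT : finGroupType) (H : {group gT}) (g : gT) (k : nat) (x : gT) :=
  [exists i : 'I_k, x * g ^- i \in H]%g.

Definition same_coset (gT : finGroupType) (H : {group gT}) (g : gT) (k : nat) :
    rel gT :=
  fun x y => (x == y) || below H g k x && (x * y^-1 \in H)%g.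

(** The state between two merging steps: the first [k] cosets form one class, the later ones are
    still separate. *)
Definition merged_cosets (gT : finGroupType) (H : {group gT}) (g : gT)
    (p k : nat) : rel gT :=
  fun x y => below H g k x && below H g k y || same_coset H g p x y.

Definition const_on (gT : finGroupType) (A : {set gT}) (e : nat) (x : gT) : nat :=
  if x \in A then e else 0.

Lemma belowP (gT : finGroupType) (H : {group gT}) (g : gT) (k : nat) (x : gT) :
  reflect (exists2 i, i < k & x * g ^- i \in H)%g (below H g k x).
Proof.
apply: (iffP existsP) => [[i xi]|[i lt_i xi]]; first by exists i.
by exists (Ordinal lt_i).
Qed.

Lemma belowMl (gT : finGroupType) (H : {group gT}) (g : gT) (k : nat) (h x : gT) :
  h \in H -> below H g k (h * x)%g = below H g k x.
Proof.
by move=> hH; rewrite /below; apply: eq_existsb => i; rewrite -mulgA (groupMl _ hH).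
Qed.

Lemma all2_map (T : eqType) (T' : Type) (S : rel T') (W : seq T)
    (f f' : T -> T') :
  (forall w, w \in W -> S (f w) (f' w)) -> all2 S (map f W) (map f' W).
Proof.
elim: W => [//|w W IH] SW /=; rewrite SW ?mem_head //=.
by apply: IH => v v_W; rewrite SW // inE v_W orbT.
Qed.

(** Right translation by [z] commutes with the variables, which act on the left, so only the
    constants of the word change. *)
Lemma partition_word_translate (gT : finGroupType) (H : {group gT}) (e : nat)
    (z : gT) :
    partition_word (const_on H e) (fun x y => (x \in H) && (y \in H)) ->
  partition_word (const_on H e)
    (fun x y => (x * z^-1 \in H) && (y * z^-1 \in H))%g.
Proof.
move=> pH C; have [N HN] := pH C; exists N => c.
have [W [szW mW cW]] := HN (fun s => c [seq (x * z)%g | x <- s]).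
pose tr (w : gT + gT) := match w with inl a => inl (a * z)%g | inr h => inr h end.
have evE x : eval_word (map tr W) x = [seq (y * z)%g | y <- eval_word W (x * z^-1)%g].
  rewrite /eval_word -!map_comp; apply: eq_map => -[a|h] //=.
  by rewrite -mulgA mulgKV.
exists (map tr W); split=> [|k|x y Sxy]; first by rewrite size_map.
  by rewrite -mW count_map; apply: eq_count => -[].
by rewrite !evE; apply: cW.
Qed.

(** The outer word takes care of the coset [H g^j]. Its variables lie in [H], so they keep a point
    of an earlier coset inside that coset, where the inner words absorb the difference. *)
Lemma partition_coset_step (gT : finGroupType) (H : {group gT}) (g : gT)
    (j e e' : nat) :
    partition_word (const_on H e) (fun x y => (x \in H) && (y \in H)) ->
    partition_word (const_on H e') (same_coset H g j) ->
  partition_word (const_on H (#|H| * (e * e'))) (same_coset H g j.+1).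
Proof.
move=> pH pS; apply: (partition_word_comp (m' := const_on H e) pS) => [C|k].
  have [N HN] := partition_word_translate (g ^+ j)%g pH C.
  exists N => c cS; have [W [szW mW cW]] := HN c; exists W; split=> // x y.
  case/orP=> [/eqP-> //|/andP[/belowP[i lt_i xi] xy]].
  have [eq_i|neq_i] := eqVneq i j.
    apply: cW; rewrite -eq_i xi -(groupMl _ xy).
    by rewrite mulgA mulgKV xi.
  apply: cS; first by rewrite size_eval_word.
  apply: all2_map => -[a|h] Ww /=; first by rewrite /same_coset eqxx.
  have hH : h \in H.
    apply/idPn => hH; move: (mW h); rewrite /const_on (negPf hH) => /eqP.
    by apply/negP; rewrite -lt0n -has_count has_pred1.
  rewrite /same_coset belowMl // invMg mulgA groupMr ?groupV //.
  rewrite -mulgA groupMl // xy andbT orbC; apply/orP; left; apply/belowP.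
  by exists i => //; rewrite ltn_neqAle neq_i.
rewrite /const_on; case: ifP => kH.
  rewrite -sum_nat_const [RHS](bigID (mem H)) /= [X in _ + X]big1 ?addn0.
    by apply: eq_bigr => h hH; rewrite hH groupMl ?groupV // hH.
  by move=> h /negPf->.
rewrite big1 // => h _; case: ifP => // hH.
by rewrite groupMr ?groupV // kH muln0.
Qed.

Lemma partition_all_cosets (gT : finGroupType) (H : {group gT}) (g : gT) (e j : nat) :
    partition_word (const_on H e) (fun x y => (x \in H) && (y \in H)) ->
  exists2 e', #|H| * e' = (#|H| * e) ^ j.+1 &
    partition_word (const_on H e') (same_coset H g j.+1).
Proof.
move=> pH; elim: j => [|j [e' eE pS]].
  exists e => // C; have [N HN] := pH C; exists N => c.
  have [W [szW mW cW]] := HN c; exists W; split=> // x y.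
  case/orP=> [/eqP-> //|/andP[/belowP[[|//] _]]].
  rewrite expg0 invg1 mulg1 => xH xy; apply: cW.
  by rewrite xH -groupV -(groupMl _ xH).
exists (#|H| * (e * e')); last exact: partition_coset_step.
by rewrite (expnS _ j.+1) -eE; lia.
Qed.

(* The variables [v_(g^a)] sit at [p] positions that are homogeneous for the
   (p-k)-subsets; at a point of [H g^j] with [j <= k] the letters that are not
   in the merged cosets are then [g^k, ..., g^(p-1)], in this order. *)
Lemma merge_next_coset (gT : finGroupType) (H : {group gT}) (g : gT) (p k : nat) :
    g \in ('N(H))%g -> (g ^+ p \in H)%g -> 0 < k < p ->
  partition_word_mod (merged_cosets H g p k)
    (fun h => \sum_(a < p) (h == g ^+ a)%g) (merged_cosets H g p k.+1).
Proof.
move=> nHg gpH /andP[k_gt0 lt_kp] C.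
have [n Hn] := ramsey_subseq nat (p - k) C p; exists n => c cS.
(* The values [g^k, ..., g^(p-1)] are placed in order on [u]; the [1] elsewhere stands for the
   merged cosets, [H] being one of them since [k > 0]. *)
pose stripped (u : seq nat) :=
  [seq (if i \in u then g ^+ (k + index i u) else 1)%g | i <- iota 0 n].
have [|t [col [sub_t sz_t colP]]] := Hn (c \o stripped) (iota 0 n).
  by rewrite size_iota.
have uniq_t : uniq t := subseq_uniq sub_t (iota_uniq _ _).
pose letter i : gT + gT :=
  if i \in t then inr (g ^+ index i t)%g else inl 1%g.
exists (map letter (iota 0 n)).
(* As [g] normalises [H], left multiplication by [g^i] carries [H g^j] into [H g^(i+j)]; [shiftH]
   then lowers an exponent by [p]. *)
have inH i j x : (x * g ^- j \in H -> g ^+ i * x * g ^- (i + j) \in H)%g.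
  move=> xj; rewrite expgD invMg -!mulgA (mulgA x) mulgA.
  by rewrite -[X in (X * _ * _)%g]invgK -mulgA -conjgE memJ_norm // groupV groupX.
have shiftH j x : p <= j -> (x * g ^- j \in H -> x * g ^- (j - p) \in H)%g.
  by move=> le_pj; rewrite -{1}(subnKC le_pj) expgD invMg mulgA groupMr ?groupV.
split; first by rewrite size_map size_iota.
  move=> h; rewrite count_map.
  rewrite (eq_count (a2 := predI (fun i => g ^+ index i t == h)%g (mem t))).
    rewrite -count_filter.
    have /subseq_uniqP <- := sub_t; last exact: iota_uniq.
    rewrite -sum1_count big_mkcond (big_nth 0) sz_t big_mkord.
    by apply: eq_bigr => a _; rewrite index_uniq ?sz_t // eq_sym; case: eqP.
  by move=> i /=; rewrite /letter; case: ifP => _; rewrite ?andbT ?andbF.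
have evE j x : j <= k -> (x * g ^- j \in H)%g ->
    c (eval_word (map letter (iota 0 n)) x) = col.
  (* The variable of index [a] takes a value in [H g^(a+j)], which is not yet merged exactly when
     [k - j <= a < p - j]; [u] is this window of [t]. *)
  move=> le_jk xj; pose u := take (p - k) (drop (k - j) t).
  have sz_u : size u = p - k by rewrite size_takel // size_drop sz_t; lia.
  have nth_u b : b < p - k -> nth 0 u b = nth 0 t (k - j + b).
    by move=> lt_b; rewrite nth_take // nth_drop.
  have sub_u : subseq u t.
    exact: subseq_trans (take_subseq _ _) (drop_subseq _ _).
  rewrite -(colP u) //=; apply: cS; first by rewrite size_map size_map size_iota.
  rewrite /eval_word -map_comp; apply: all2_map => i _ /=; rewrite /letter.
  have [it|it] := boolP (i \in t); last first.
    have /negPf-> /= : i \notin u by apply: contra it; apply: (mem_subseq sub_u).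
    by rewrite /merged_cosets /same_coset eqxx orbT.
  have lt_a : index i t < p by rewrite -sz_t index_mem.
  set a := index i t in lt_a *; rewrite /merged_cosets /=.
  have [iu|iu] := boolP (i \in u).
    have lt_b : index i u < p - k by rewrite -sz_u index_mem.
    set b := index i u in lt_b *.
    have aE : a = k - j + b.
      by rewrite /a -[i in LHS](nth_index 0 iu) -/b nth_u // index_uniq // sz_t; lia.
    have -> : k + b = a + j by lia.
    apply/orP; right; rewrite /same_coset inH // andbT; apply/orP; right.
    by apply/belowP; exists (a + j); [lia | exact: inH].
  apply/orP; left; apply/andP; split; last first.
    by apply/belowP; exists 0; rewrite // expg0 invg1 mulg1.
  (* Outside the window, either [a + j] is below [k], or it wraps around to [a + j - p], again below
     [k]. *)
  have out : (a < k - j) || (p - j <= a).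
    apply: contraR iu; rewrite negb_or -leqNgt -ltnNge => /andP[le_a lt_a'].
    have <- : nth 0 u (a - (k - j)) = i.
      by rewrite nth_u ?subnKC ?nth_index //; lia.
    by apply: mem_nth; rewrite sz_u; lia.
  apply/belowP; case/orP: out => cmp.
    by exists (a + j); [lia | exact: inH].
  by exists (a + j - p); [lia | apply: shiftH; [lia | exact: inH]].
move=> x y /orP[/andP[/belowP[i lt_i xi] /belowP[j lt_j yj]]|].
  by rewrite (evE i) // (evE j).
case/orP=> [/eqP-> //|/andP[/belowP[j lt_j xj] xy]].
apply: cS; first by rewrite !size_map size_iota.
apply: all2_map => w /mapP[i _ ->]; rewrite /letter; apply/orP; right.
case: ifP => [it|_] /=; last by rewrite /same_coset eqxx.
have lt_a : index i t < p by rewrite -sz_t index_mem.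
set a := index i t in lt_a *.
apply/orP; right; apply/andP; split.
  apply/belowP; have [lt_p|le_p] := ltnP (a + j) p.
    by exists (a + j) => //; apply: inH.
  by exists (a + j - p); [lia | apply: shiftH => //; apply: inH].
(* The case [j = 0] of [inH] is conjugation by [g^a], which preserves [H]. *)
rewrite invMg !mulgA.
by have := inH a 0 (x * y^-1)%g; rewrite expg0 invg1 mulg1 addn0 !mulgA; apply.
Qed.

(** A generator of the quotient is lifted to [K]; its powers below the order of the quotient
    represent each coset exactly once. *)
Lemma cyclic_quotient_generator (gT : finGroupType) (H K : {group gT}) :
    (H <| K)%g -> cyclic (K / H)%g ->
  exists g, [/\ g \in ('N(H))%g, g \in K, (g ^+ #|K / H| \in H)%g,
    forall x, x \in K -> exists2 i, i < #|K / H|%g & (x * g ^- i \in H)%g &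
    forall x i j, i < #|K / H|%g -> j < #|K / H|%g -> x \in K ->
      (x * g ^- i \in H)%g -> (x * g ^- j \in H)%g -> i = j].
Proof.
move=> /andP[_ nHK] /cyclicP[gbar defKH].
have: gbar \in (K / H)%g by rewrite defKH cycle_id.
case/morphimP=> g nHg gK def_gbar; exists g.
have ord : #|(K / H)%g| = #[gbar]%g by rewrite defKH.
have cosetX i : coset H (g ^+ i)%g = (gbar ^+ i)%g by rewrite morphX // def_gbar.
have cosetV x i : x \in K -> (x * g ^- i \in H)%g -> coset H x = (gbar ^+ i)%g.
  by rewrite -mem_rcoset -cosetX => xK /rcoset_kercosetP -> //;
     rewrite ?groupX ?(subsetP nHK).
split=> //.
- by apply: coset_idr; rewrite ?groupX // cosetX ord expg_order.
- move=> x xK; have: coset H x \in (K / H)%g by apply: mem_quotient.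
  rewrite {1}defKH => /cyclePmin[i lt_i xi]; exists i; first by rewrite ord.
  rewrite -mem_rcoset; apply/rcoset_kercosetP; rewrite ?groupX ?(subsetP nHK) //.
  by rewrite cosetX.
move=> x i j; rewrite ord => lt_i lt_j xK /(cosetV _ _ xK)xi /(cosetV _ _ xK)/eqP.
by rewrite xi eq_expg_mod_order !modn_small // => /eqP.
Qed.

Lemma sum_powers (gT : finGroupType) (g k : gT) (p : nat) (m : gT -> nat) :
  \sum_h (\sum_(a < p) (h == g ^+ a)%g) * m (k * h^-1)%g =
    \sum_(a < p) m (k * g ^- a)%g.
Proof.
under eq_bigr do rewrite big_distrl /=.
rewrite exchange_big /=; apply: eq_bigr => a _.
rewrite (bigD1 (g ^+ a)%g) //= eqxx mul1n big1 ?addn0 // => h /negPf->.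
by rewrite mul0n.
Qed.

(** * Degrees along the series and conclusion *)

Definition uniform_partition (gT : finGroupType) (G : {group gT}) (d : nat) :=
  exists2 e, #|G| * e = d &
    partition_word (const_on G e) (fun x y => (x \in G) && (y \in G)).

Lemma uniform_partition1 (gT : finGroupType) (G : {group gT}) :
  G :=: 1%g -> uniform_partition G 1.
Proof.
move=> G1; exists 1; first by rewrite G1 cards1.
move=> C; exists 1 => c; exists [:: inr 1%g]; split=> // [k|x y].
  rewrite /const_on G1 inE /= addn0; have [->|neq] := eqVneq k 1%g.
    by rewrite eqxx.
  by apply/eqP; rewrite eqb0; apply: contra neq => /eqP[->].
by rewrite G1 !inE => /andP[/eqP-> /eqP->].
Qed.

Lemma uniform_partition_extension (gT : finGroupType) (H K : {group gT}) (d : nat) :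
    (H <| K)%g -> cyclic (K / H)%g -> uniform_partition H d ->
  uniform_partition K (d ^ #|K / H|%g * #|K / H|%g ^ (#|K / H|%g - 1)).
Proof.
move=> nHK cycKH [e <- pH].
have [g [nHg gK]] := cyclic_quotient_generator nHK cycKH.
have cardK : #|H| * #|(K / H)%g| = #|K|.
  by rewrite card_quotient ?normal_norm // Lagrange ?normal_sub.
set p := #|(K / H)%g| in cardK * => gpH exP uniqP.
have p_gt0 : 0 < p by apply: cardG_gt0.
have [e1 e1E p1] := partition_all_cosets g p.-1 pH.
rewrite prednK // in e1E p1.
(* Here [k] counts merging steps. The first one passes from variables in [H] to variables in [K] and
   keeps [e1] occurrences of each, since an element of [K] lies in exactly one coset [H g^a]. Each
   later step multiplies the occurrences by [p]. *)
have merged k : 0 < k < p -> exists2 e', #|K| * e' = #|H| * e1 * p ^ k &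
    partition_word (const_on K e') (merged_cosets H g p k.+1).
  elim: k => [//|k IHk] /= lt_k; have [k0|k_gt0] := posnP k.
    rewrite k0 in lt_k *; exists e1; first by rewrite -cardK expn1 mulnAC.
    have p1' : partition_word (const_on H e1) (merged_cosets H g p 1).
      move=> C; have [N HN] := p1 C; exists N => c; have [W [szW mW cW]] := HN c.
      exists W; split=> // x y /orP[|]; last exact: cW.
      case/andP=> /belowP[[|//] _ xH] /belowP[[|//] _ yH]; apply: cW.
      rewrite expg0 invg1 !mulg1 in xH yH; rewrite /same_coset groupM ?groupV //.
      apply/orP; right; rewrite andbT; apply/belowP; exists 0 => //.
      by rewrite expg0 invg1 mulg1.
    apply: (partition_word_comp p1' (merge_next_coset nHg gpH _)) => // k'.
    rewrite sum_powers /const_on; case: ifP => k'K.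
      have [i lt_i iP] := exP _ k'K; rewrite (bigD1 (Ordinal lt_i)) //= iP.
      rewrite big1 ?addn0 // => j neq_j; case: ifP => // jP.
      by case/eqP: neq_j; apply: val_inj; apply: (uniqP k' j i) => //; apply: ltn_ord.
    rewrite big1 // => j _; case: ifP => // /(subsetP (normal_sub nHK)).
    by rewrite groupMr ?k'K // groupV groupX.
  have [|e' e'E pk] := IHk; first by rewrite k_gt0 ltnW.
  exists (p * e'); first by rewrite expnS mulnCA e'E mulnCA.
  apply: (partition_word_comp pk (merge_next_coset nHg gpH _)) => [|k'].
    by rewrite /= lt_k.
  rewrite sum_powers /const_on.
  under eq_bigr do rewrite groupMr ?groupV ?groupX //.
  by rewrite sum_nat_const card_ord; case: ifP; rewrite ?muln0.
have Kp x : x \in K -> below H g p x by move=> xK; apply/belowP; apply: exP.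
(* For [p = 1] there is nothing to merge, and [K] equals [H]. *)
have [p1E|p_gt1] : p = 1 \/ 1 < p by lia.
  have defK : K :=: H.
    by apply/esym/eqP; rewrite eqEcard normal_sub // -cardK p1E muln1 leqnn.
  by exists e; rewrite ?defK // p1E muln1 expn1.
have [|e' e'E pk] := merged p.-1; first by lia.
exists e'; first by rewrite e'E e1E subn1.
rewrite prednK // in pk => C; have [N HN] := pk C; exists N => c.
have [W [szW mW cW]] := HN c; exists W; split=> // x y /andP[xK yK].
by apply: cW; rewrite /merged_cosets !Kp.
Qed.

Lemma uniform_partition_series (gT : finGroupType) (K : nat -> {group gT}) (n : nat) :
    K 0 :=: 1%g ->
    (forall i, i < n -> (K i <| K i.+1)%g /\ cyclic (K i.+1 / K i)%g) ->
  uniform_partition (K n) (\prod_(0 <= i < n)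
    factor_order K i ^ ((factor_order K i - 1)
                        * \prod_(i.+1 <= j < n) factor_order K j)).
Proof.
move=> K0; elim: n => [|n IHn] serK; first by rewrite big_nil; apply: uniform_partition1.
have [nK cK] := serK n (ltnSn n).
rewrite big_nat_recr //= [X in _ ^ (_ * X)]big_geq // muln1.
(* Appending a factor multiplies every earlier exponent by its order, that is, raises the earlier
   product to that power. *)
suff -> : \prod_(0 <= i < n) factor_order K i ^ ((factor_order K i - 1)
    * \prod_(i.+1 <= j < n.+1) factor_order K j) =
    (\prod_(0 <= i < n) factor_order K i ^ ((factor_order K i - 1)
    * \prod_(i.+1 <= j < n) factor_order K j)) ^ factor_order K n.
  by apply: uniform_partition_extension => //; apply: IHn => i lt_i; apply/serK/ltnW.
rewrite (big_morph _ (fun a b => expnMn a b _) (exp1n _)) !big_mkord.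
by apply: eq_bigr => i _; rewrite big_nat_recr // mulnA expnM.
Qed.

Theorem theorem1p5 (gT : finGroupType) (d r : nat)
    (solG : solvable [set: gT]) (degd : is_HJ_degree [set: gT]%G d)
    (r_gt0 : 0 < r) :
  exists N : nat, 0 < N /\
    forall c : {ffun 'I_N -> gT} -> 'I_r,
      exists W : word gT gT N,
        [/\ is_variable_word [set: gT] W,
            uniform_word [set: gT] W,
            word_degree [set: gT] W = d
          & monochromatic c
              [set word_subst (fun h x : gT => (h * x)%g) W g | g in [set: gT]]].
Proof.
have [n [K [[K0 Kn serK] dE]]] := degd.
have d_gt0 : 0 < d.
  rewrite dE big_mkord; apply: (big_ind (leq 1)) => // [a b|i _]; first by rewrite muln_gt0 => -> ->.
  by rewrite expn_gt0 cardG_gt0.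
have := uniform_partition_series K0 serK; rewrite -dE => -[e eE pK].
have e_gt0 : 0 < e by case: e eE d_gt0 {pK} => // <-; rewrite muln0.
have inK x : x \in K n by rewrite Kn inE.
have [N HN] := pK 'I_r; exists N; split.
  (* A constant colouring already provides a word; it contains the variable [v_1], so its length is
     positive. *)
  have [W [<- mW _]] := HN (fun=> Ordinal r_gt0).
  apply: leq_trans (count_size (pred1 (inr 1%g)) W).
  by rewrite mW /const_on inK.
(* The default [1] is read only on lists shorter than [N], whereas the values of [W] have length
   [N]. *)
move=> c; have [W [/eqP szW mW cW]] := HN (fun s => c [ffun i : 'I_N => nth 1%g s i]).
pose t := Tuple szW; exists [ffun i => tnth t i].
have posE h : #|var_pos [ffun i => tnth t i] h| = e.
  have := mW h; rewrite /const_on inK => <-.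
  rewrite -[W in RHS]/(tval t) -[in RHS](map_tnth_enum t) count_map.
  rewrite -size_filter cardE; congr size; rewrite /enum_mem -enumT /=.
  by rewrite -filter_predI; apply: eq_filter => i /=; rewrite !inE ffunE andbT.
split=> [|h k _ _||].
- split=> [|//|h _]; first by apply/set0Pn; exists 1%g; rewrite inE.
  by rewrite -card_gt0 posE.
- by rewrite !posE.
- by rewrite /word_degree; under eq_bigr do rewrite posE; rewrite sum_nat_const -Kn.
have substE x : word_subst (fun h x => (h * x)%g) [ffun i => tnth t i] x =
    [ffun i : 'I_N => nth 1%g (eval_word W x) i].
  apply/ffunP => i; rewrite !ffunE (tnth_nth (inl 1%g)) /= (nth_map (inl 1%g)) //.
  by rewrite (eqP szW).
by move=> _ _ /imsetP[x _ ->] /imsetP[y _ ->]; rewrite !substE; apply: cW; rewrite !inK.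
Qed.
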